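(* Let $\mathbb{S}^2\subset\mathbb{R}^3$ be the unit sphere with its induced Euclidean metric, let $N=(0,0,1)$ and $S=(0,0,-1)$, and let $M=\mathbb{S}^2\setminus\{N,S\}$. Let $\vec v$ be a smooth unit vector field defined on $M$. If $k=\max\{I_{\vec v}(N),I_{\vec v}(S)\}$, then \[ \mathrm{vol}(\vec v)\ \ge\ \pi\, L(\varepsilon_k), \] where $L(\varepsilon_k)$ is the length of the ellipse $\varepsilon_k:\ \frac{x^2}{k^2}+\frac{y^2}{(k-2)^2}=1$, with $k>2$.
   Context: $I_{\vec v}(P)$ denotes the Poincaré index of $\vec v$ around the isolated singular point $P\in\{N,S\}$. The volume $\mathrm{vol}(\vec v)$ of the unit vector field is the area of the surface $\vec v(M)$ in the unit tangent bundle $T^1\mathbb{S}^2$ equipped with the Sasaki metric; equivalently, if $g$ is the round metric, $\nabla$ its Levi-Civita connection, $\nu$ the area form, and $\vec v^{\perp}$ is the unit vector field such that $\{\vec v^{\perp},\vec v\}$ is a positively oriented orthonormal frame, then \[ \mathrm{vol}(\vec v)=\int_M\sqrt{1+\gamma^2+\delta^2}\,\nu,\qquad \gamma=g(\nabla_{\vec v}\vec v,\vec v^{\perp}),\quad \delta=g(\nabla_{\vec v^{\perp}}\vec v^{\perp},\vec v). \] *)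

(* Defs.v *)
From HB Require Import structures.
From mathcomp Require Import all_boot all_order all_algebra.
From mathcomp Require Import all_classical all_reals all_analysis.
Set Implicit Arguments. Unset Strict Implicit. Unset Printing Implicit Defensive.
Import Order.TTheory GRing.Theory Num.Theory numFieldNormedType.Exports.
Local Open Scope classical_set_scope.
Local Open Scope ring_scope.

Section Sphere.
Variable R : realType.

Definition vec3 := (R * R * R)%type.
Definition vx (p : vec3) : R := p.1.1.
Definition vy (p : vec3) : R := p.1.2.
Definition vz (p : vec3) : R := p.2.
Definition mk3 (x y z : R) : vec3 := (x, y, z).
Definition dot3 (p q : vec3) : R := vx p * vx q + vy p * vy q + vz p * vz q.
Definition cross3 (p q : vec3) : vec3 :=
  mk3 (vy p * vz q - vz p * vy q) (vz p * vx q - vx p * vz q)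
      (vx p * vy q - vy p * vx q).
Definition add3 (p q : vec3) : vec3 := mk3 (vx p + vx q) (vy p + vy q) (vz p + vz q).
Definition scale3 (a : R) (p : vec3) : vec3 := mk3 (a * vx p) (a * vy p) (a * vz p).

Definition North : vec3 := mk3 0 0 1.
Definition South : vec3 := mk3 0 0 (-1).
Definition M : set vec3 := [set p | dot3 p p = 1 /\ p <> North /\ p <> South].

(* spherical chart: colatitude t in ]0,pi[, longitude s; it covers M *)
Definition sph (t s : R) : vec3 := mk3 (sin t * cos s) (sin t * sin s) (cos t).
Definition e_t (t s : R) : vec3 := mk3 (cos t * cos s) (cos t * sin s) (- sin t).
Definition e_s (t s : R) : vec3 := mk3 (- sin s) (cos s) 0.
Definition chart_dom : set (R * R) := [set z | 0 < z.1 < pi].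

Definition d1 (f : R -> R -> R) : R -> R -> R := fun t s => derive1 (fun u => f u s) t.
Definition d2 (f : R -> R -> R) : R -> R -> R := fun t s => derive1 (fun u => f t u) s.

Fixpoint Cn (n : nat) (U : set (R * R)) (f : R -> R -> R) : Prop :=
  match n with
  | 0%N => forall z, U z -> {for z, continuous (fun w : R * R => f w.1 w.2)}
  | n'.+1 => (forall z, U z -> derivable (fun u => f u z.2) z.1 1 /\
                               derivable (fun u => f z.1 u) z.2 1) /\
             Cn n' U f /\ Cn n' U (d1 f) /\ Cn n' U (d2 f)
  end.
Definition smooth_on (U : set (R * R)) (f : R -> R -> R) := forall n, Cn n U f.

(* a smooth unit tangent vector field on M: v is given at every point of R^3
   but only its values on M matter; smoothness is tested in the chart sph,
   which is a local diffeomorphism from ]0,pi[ x R onto M *)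
Definition smooth_unit_field (v : vec3 -> vec3) : Prop :=
  (forall p, M p -> dot3 (v p) p = 0 /\ dot3 (v p) (v p) = 1) /\
  smooth_on chart_dom (fun t s => vx (v (sph t s))) /\
  smooth_on chart_dom (fun t s => vy (v (sph t s))) /\
  smooth_on chart_dom (fun t s => vz (v (sph t s))).

Definition inchart (v : vec3 -> vec3) : R -> R -> vec3 := fun t s => v (sph t s).
Definition pd1 (F : R -> R -> vec3) : R -> R -> vec3 := fun t s =>
  mk3 (d1 (fun a b => vx (F a b)) t s) (d1 (fun a b => vy (F a b)) t s)
      (d1 (fun a b => vz (F a b)) t s).
Definition pd2 (F : R -> R -> vec3) : R -> R -> vec3 := fun t s =>
  mk3 (d2 (fun a b => vx (F a b)) t s) (d2 (fun a b => vy (F a b)) t s)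
      (d2 (fun a b => vz (F a b)) t s).

(* Euclidean directional derivative D_w X at sph t s of a field X given in the
   chart by F, along the tangent vector w (since d sph/dt = e_t and
   d sph/ds = sin t * e_s) *)
Definition dirder (F : R -> R -> vec3) (t s : R) (w : vec3) : vec3 :=
  add3 (scale3 (dot3 w (e_t t s)) (pd1 F t s))
       (scale3 (dot3 w (e_s t s) / sin t) (pd2 F t s)).

(* v^perp : {v^perp, v} positively oriented orthonormal (outward normal p),
   i.e. v^perp x v = p, i.e. v^perp = v x p *)
Definition vperp (v : vec3 -> vec3) : vec3 -> vec3 := fun p => cross3 (v p) p.

(* gamma = g(nabla_v v, v^perp), delta = g(nabla_{v^perp} v^perp, v); the
   Levi-Civita connection of the round sphere is the tangential part of the
   Euclidean derivative, and pairing with a tangent vector ignores the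
   normal part *)
Definition gam (v : vec3 -> vec3) (t s : R) : R :=
  dot3 (dirder (inchart v) t s (v (sph t s))) (vperp v (sph t s)).
Definition del (v : vec3 -> vec3) (t s : R) : R :=
  dot3 (dirder (inchart (vperp v)) t s (vperp v (sph t s))) (v (sph t s)).

Definition vol_dom : set (R * R) := `]0, pi[%classic `*` `]0, 2 * pi[%classic.
(* vol(v) = int_M sqrt(1 + gamma^2 + delta^2) dA, with dA = sin t dt ds *)
Definition vol (v : vec3 -> vec3) : \bar R :=
  (\int[(@lebesgue_measure R \x @lebesgue_measure R)%E]_(z in vol_dom)
     (Num.sqrt (1 + gam v z.1 z.2 ^+ 2 + del v z.1 z.2 ^+ 2) * sin z.1)%:E)%E.

Definition winding (cx cy : R -> R) (n : int) : Prop :=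
  exists th r : R -> R,
    {within `[0, 2 * pi]%classic, continuous th} /\
    (forall s, 0 <= s <= 2 * pi ->
       0 < r s /\ cx s = r s * cos (th s) /\ cy s = r s * sin (th s)) /\
    th (2 * pi) - th 0 = 2 * pi * n%:~R.

(* Poincare index at N: winding number of v, expressed in the (oriented)
   trivialisation given by orthogonal projection on the xy-plane, along small
   circles of colatitude eps around N (parametrised positively) *)
Definition index_N (v : vec3 -> vec3) (n : int) : Prop :=
  exists e0 : R, 0 < e0 /\ forall eps, 0 < eps < e0 ->
    winding (fun s => vx (v (sph eps s))) (fun s => vy (v (sph eps s))) n.
(* Poincare index at S: on the circle of colatitude pi - eps, increasing s
   is negatively oriented w.r.t. the outward normal, and the projection on
   the xy-plane is orientation reversing near S; the two sign changes cancel *)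
Definition index_S (v : vec3 -> vec3) (n : int) : Prop :=
  exists e0 : R, 0 < e0 /\ forall eps, 0 < eps < e0 ->
    winding (fun s => vx (v (sph (pi - eps) s))) (fun s => vy (v (sph (pi - eps) s))) n.

Definition seg (a b : R) : set R := `[a, b]%classic.
Definition curve_length (cx cy : R -> R) (a b : R) : \bar R :=
  (\int[@lebesgue_measure R]_(t in seg a b)
      (Num.sqrt ((derive1 cx t) ^+ 2 + (derive1 cy t) ^+ 2))%:E)%E.

Definition ellipse_length (k : R) : \bar R :=
  curve_length (fun t => k * cos t) (fun t => (k - 2) * sin t) 0 (2 * pi).

End Sphere.

(* Main.v *)
Require Import Defs.
From HB Require Import structures.
From mathcomp Require Import all_boot all_order all_algebra.
From mathcomp Require Import all_classical all_reals all_analysis.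
From mathcomp Require Import measurable_realfun ring lra.
Set Implicit Arguments. Unset Strict Implicit. Unset Printing Implicit Defensive.
Import Order.TTheory GRing.Theory Num.Theory numFieldNormedType.Exports.
Local Open Scope classical_set_scope.
Local Open Scope ring_scope.

(** Write v = cos phi e_t + sin phi e_s in the spherical frame.  The volume
    density is sqrt (sin^2 t + sin^2 t (d_t phi)^2 + (d_s phi + cos t)^2) dt ds, so
    dropping the d_t phi term only decreases it.  Along each parallel phi turns by
    2 pi m, where m does not depend on the parallel by homotopy invariance;
    comparing v with its projection to the xy-plane near the poles gives
    m = I(N) - 1 = 1 - I(S), hence m = k - 1 or m = 1 - k.  By convexity the
    integral over the parallel of colatitude t is at least
    2 pi sqrt (sin^2 t + (m + cos t)^2) = 2 pi sqrt (1 + m^2 + 2 m cos t).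
    Integrating in t gives pi L(eps_k), because the ellipse has speed
    sqrt (1 + (k - 1)^2 - 2 (k - 1) cos 2u). *)

Lemma continuous_slice (T U V : topologicalType) (f : T -> U -> V) t u :
  {for (t, u), continuous (fun z => f z.1 z.2)} -> {for u, continuous (f t)}.
Proof.
move=> cf; apply: (@continuous_comp _ _ _ (pair t) (fun z => f z.1 z.2)) cf.
by apply: (@cvg_pair _ _ _ (nbhs u) (nbhs t) (nbhs u)); [exact: cvg_cst|exact: cvg_id].
Qed.

Lemma near_compact_gt0 (R : realType) (T U : topologicalType) (K : set U)
    (G : T * U -> R) t : compact K ->
  (forall u, K u -> {for (t, u), continuous G}) -> (forall u, K u -> 0 < G (t, u)) ->
  \forall x \near t, forall u, K u -> 0 < G (x, u).
Proof.
move=> /compact_near_coveringP cK cG G_gt0.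
apply: (cK T (nbhs t) (fun x u => 0 < G (x, u))) => u Ku.
have cGswap : {for (u, t), continuous (G \o swap_pair)}.
  by apply: continuous_comp; [exact: swap_continuous|exact: cG].
by have := cGswap [set y | 0 < y]; apply; exact: lt_nbhsr (G_gt0 u Ku).
Qed.

Section Primitives.
Variable R : realType.
Implicit Types (f g F : R -> R) (a b c x y z : R) (i : interval R).

Lemma is_derive1M f g x (df dg : R) : is_derive x 1 f df -> is_derive x 1 g dg ->
  is_derive x 1 (fun y => f y * g y) (df * g x + f x * dg).
Proof.
move=> fx gx; apply: (is_derive_eq (is_deriveM fx gx)).
by rewrite addrC; congr (_ + _); exact: mulrC.
Qed.

Lemma is_derive1_cstM f x c (df : R) : is_derive x 1 f df ->
  is_derive x 1 (fun y => c * f y) (c * df).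
Proof. by move=> fx; exact: is_deriveZ. Qed.

Lemma is_derive1_continuous f x (df : R) : is_derive x 1 f df ->
  {for x, continuous f}.
Proof. by case=> fx _; exact/differentiable_continuous/derivable1_diffP. Qed.

Lemma is_derive0_cst_itv i F : {in i, forall z, is_derive z 1 F 0} ->
  {in i &, forall x y, F x = F y}.
Proof.
move=> dF x y; wlog xy : x y / x <= y => [H xi yi|xi yi].
  by case: (leP x y) => [/H|/ltW /H H']; [exact|rewrite H'].
have sub z : x <= z <= y -> z \in i.
  exact: (@interval_is_interval _ i x y xi yi).
have [z||c _] := @MVT_segment R F (fun=> 0) x y xy.
- by rewrite in_itv/= => /andP[/ltW xz /ltW zy]; apply/dF/sub/andP.
- by apply: derivable_within_continuous => z; rewrite in_itv/= => /sub/dF[].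
- by rewrite mul0r => /eqP; rewrite subr_eq0 => /eqP ->.
Qed.

Lemma locally_cst_itv (T : Type) i (h : R -> T) :
  {in i, forall t, \forall u \near t, h u = h t} ->
  {in i &, forall x y, h x = h y}.
Proof.
move=> lh x y xi yi; pose same u : R := (`[< h u = h y >])%:R.
have : same x = same y.
  apply: (is_derive0_cst_itv (i := i)) => // t /lh ht.
  apply: (near_eq_is_derive (f := cst (same t))).
  by near=> u; rewrite /cst /same; congr (`[< _ = _ >]%:R); apply/esym; near: u.
rewrite /same (asboolT (erefl (h y))); case: asboolP => // _ /eqP.
by rewrite eq_sym oner_eq0.
Unshelve. all: by end_near. Qed.

Lemma continuous_integrable_segment f a b : continuous f ->
  lebesgue_measure.-integrable `[a, b] (EFin \o f).
Proof.
move=> cf; apply: continuous_compact_integrable; first exact: segment_compact.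
exact: continuous_subspaceT.
Qed.

Lemma continuous_primitive_right f a : continuous f ->
  exists F, forall x, a < x -> is_derive x 1 F (f x).
Proof.
move=> cf; exists (parameterized_integral lebesgue_measure a ^~ f) => x ax.
have int_f := continuous_integrable_segment a (x + 1) cf.
have [|dF FE] := continuous_FTC1_closed _ int_f ax (cf x); first by rewrite ltrDl.
by split; [exact: dF|rewrite -derive1E; exact: FE].
Qed.

Lemma continuous_primitive f : continuous f ->
  exists F, forall x, is_derive x 1 F (f x).
Proof.
move=> cf; have [P dP] := choice (fun a => @continuous_primitive_right f a cf).
pose F x := P (- `|x| - 1) x - P (- `|x| - 1) 0; exists F => x.
have [a0 ax] : - `|x| - 1 < 0 /\ - `|x| - 1 < x.
  by have := ler_norm (- x); have := normr_ge0 x; rewrite normrN; lra.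
set a := - `|x| - 1 in a0 ax.
have FE y : a < y -> P a y - P a 0 = F y.
  move=> ay; rewrite /F; set b := - `|y| - 1.
  have [b0 yb] : b < 0 /\ b < y.
    by have := ler_norm (- y); have := normr_ge0 y; rewrite normrN /b; lra.
  have := @is_derive0_cst_itv `]Num.max a b, +oo[ (fun z => P a z - P b z).
  have d0 z : z \in `]Num.max a b, +oo[ -> is_derive z 1 (fun z => P a z - P b z) 0.
    rewrite in_itv/= andbT gt_max => /andP[az bz].
    by apply: (is_derive_eq (is_deriveB (dP a z az) (dP b z bz))); rewrite subrr.
  move/(_ d0 y 0); rewrite !in_itv/= !andbT !gt_max ay a0 b0 yb => /(_ isT isT).
  lra.
apply: (near_eq_is_derive (f := fun y => P a y - P a 0)).
  by near=> y; apply: FE; near: y; exact: lt_nbhsr.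
by apply: (is_derive_eq (is_deriveB (dP a x ax) (is_derive_cst _ x 1))); rewrite subr0.
Unshelve. all: by end_near. Qed.

Lemma continuous_integral_oo f a b : continuous f ->
  (\int[lebesgue_measure]_(x in `]a, b[) (f x)%:E =
   \int[lebesgue_measure]_(x in `[a, b]) (f x)%:E)%E.
Proof.
move=> cf; apply/esym/(@integral_itv_bndoo R a b (EFin \o f) true false).
by apply/measurable_EFinP/measurable_funTS; exact: continuous_measurable_fun.
Qed.

Lemma integral_primitive f F a b : a < b -> continuous f ->
  (forall x, is_derive x 1 F (f x)) ->
  (\int[lebesgue_measure]_(x in `[a, b]) (f x)%:E = (F b - F a)%:E)%E.
Proof.
move=> ab cf dF; have cF x := is_derive1_continuous (dF x).
rewrite (@continuous_FTC2 R f F a b ab) ?EFinB//.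
- exact: continuous_subspaceT.
- split; first by move=> x _; have [] := dF x.
  + exact/cvg_at_right_filter/cF.
  + exact/cvg_at_left_filter/cF.
- by move=> x _; rewrite derive1E; have [] := dF x.
Qed.

Lemma primitive_periodic f F (T : R) : (forall x, is_derive x 1 F (f x)) ->
  periodic f T -> forall x y, F (x + T) - F x = F (y + T) - F y.
Proof.
move=> dF fT x y; apply: (is_derive_0_is_cst (f := fun x => F (x + T) - F x)) => z.
have dz : is_derive z 1 (fun x => x + T) 1.
  have := is_deriveD (is_derive_id z 1) (is_derive_cst T z 1).
  by move/is_derive_eq; apply; rewrite addr0.
apply: (is_derive_eq (is_deriveB (is_derive1_comp (dF _) dz) (dF z))).
by rewrite mulr1 fT subrr.
Qed.

Lemma primitive_even f F : (forall x, is_derive x 1 F (f x)) ->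
  (forall x, f (- x) = f x) -> forall x, F x + F (- x) = 2 * F 0.
Proof.
move=> dF f_even x; have -> : 2 * F 0 = F 0 + F (- 0) by rewrite oppr0; lra.
apply: (is_derive_0_is_cst (f := fun x => F x + F (- x))) => z.
apply: (is_derive_eq (is_deriveD (dF z) (is_derive1_comp (dF _) (is_deriveNid z 1)))).
by rewrite f_even mulrN1 subrr.
Qed.

End Primitives.

Section Winding.
Variable R : realType.
Implicit Types (cx cy dx dy p q w th : R -> R) (a b s x y : R) (m n : int).

Let pi2_gt0 : 0 < 2 * pi :> R. Proof. by rewrite mulr_gt0// pi_gt0. Qed.

Lemma unit_circle_angle x y : x ^+ 2 + y ^+ 2 = 1 ->
  exists a, x = cos a /\ y = sin a.
Proof.
move=> xy1; have x1 : -1 <= x <= 1 by nra.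
have sin_acosE : sin (acos x) = `|y|.
  by rewrite sin_acos// -xy1 addrC addKr sqrtr_sqr.
have [y0|y0] := leP 0 y; [exists (acos x)|exists (- acos x)].
- by rewrite acosK// sin_acosE ger0_norm.
- by rewrite cosN sinN acosK// sin_acosE ltr0_norm// opprK.
Qed.

Lemma cosD2piz x n : cos (x + 2 * pi * n%:~R) = cos x.
Proof.
have cosD2pin k y : cos (y + 2 * pi * k%:R) = cos y.
  rewrite -(periodicn (@cosD2pi R) k y); congr (cos (_ + _)).
  by rewrite mulr_natr mulr_natl.
case: (intP n) => [|k|k]; rewrite ?mulr0 ?addr0//; first exact: cosD2pin.
by rewrite -(cosD2pin k.+1 (x + _)); congr cos; rewrite mulrNz mulrN addrNK.
Qed.

Lemma cos_eq1 x : cos x = 1 -> exists n : int, x = 2 * pi * n%:~R.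
Proof.
move=> cx; pose n := Num.floor ((x + pi) / (2 * pi)); exists n.
have /andP[] := mem_rg1_floor ((x + pi) / (2 * pi)); rewrite -/n.
rewrite ler_pdivlMr// ltr_pdivrMr// => n_le n_gt.
apply/eqP; rewrite -subr_eq0 -normr_eq0; apply/eqP/cos_inj.
- rewrite in_itv/= normr_ge0/= ler_norml; lra.
- by rewrite in_itv/= lexx pi_ge0.
- by rewrite cos_norm cos0 -[RHS]cx -(cosD2piz _ n) subrK.
Qed.

Lemma eq_cos_sin x y : cos x = cos y -> sin x = sin y ->
  exists n : int, x - y = 2 * pi * n%:~R.
Proof.
by move=> cxy sxy; apply: cos_eq1; rewrite cosB cxy sxy -!expr2 cos2Dsin2.
Qed.

(* Otherwise the angle would pass through [D a + pi] or [D a - pi], where its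
   cosine is negative. *)
Lemma cos_gt0_no_turn (D : R -> R) a b n : a <= b ->
  {within `[a, b]%classic, continuous D} ->
  (forall s, a <= s <= b -> 0 < cos (D s)) ->
  D b - D a = 2 * pi * n%:~R -> n = 0.
Proof.
move=> ab cD cosD_gt0 D_turn; have pi0 := pi_gt0 R.
have cosDa : 0 < cos (D a) by apply: cosD_gt0; rewrite lexx.
have avoid x : cos x = - cos (D a) ->
    Num.min (D a) (D b) <= x <= Num.max (D a) (D b) -> False.
  move=> cosx /(IVT ab cD)[s]; rewrite in_itv/= => sab Ds.
  by have := cosD_gt0 s sab; rewrite Ds cosx; lra.
case: (ltgtP n 0) => // n0; exfalso.
- have n1 : (n%:~R : R) <= -1 by rewrite -[leRHS](mulrNz 1 1) ler_int; case: n n0 {D_turn}.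
  have D_le : D b <= D a - 2 * pi by nra.
  apply: (avoid (D a - pi)); first by rewrite -[in RHS](subrK pi (D a)) cosDpi opprK.
  by rewrite ge_min le_max; apply/andP; split; apply/orP; [right|left]; lra.
- have n1 : 1 <= (n%:~R : R) by rewrite -[leLHS]/(1%:~R) ler_int; case: n n0 {D_turn} => -[].
  have D_ge : D a + 2 * pi <= D b by nra.
  apply: (avoid (D a + pi)); first exact: cosDpi.
  by rewrite ge_min le_max; apply/andP; split; apply/orP; [left|right]; lra.
Qed.

Lemma winding_dot_gt0 cx cy dx dy m n : winding cx cy m -> winding dx dy n ->
  (forall s, 0 <= s <= 2 * pi -> 0 < cx s * dx s + cy s * dy s) -> m = n.
Proof.
move=> [th [r [cth [c_polar th_turn]]]] [ph [q [cph [d_polar ph_turn]]]] dot_gt0.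
apply/eqP; rewrite -subr_eq0; apply/eqP.
apply: (cos_gt0_no_turn (D := fun s => th s - ph s) (ltW pi2_gt0)).
- by move=> s; apply: cvgB; [exact: cth|exact: cph].
- move=> s s2pi; have [r0 [cxE cyE]] := c_polar s s2pi.
  have [q0 [dxE dyE]] := d_polar s s2pi; have := dot_gt0 s s2pi.
  suff -> : cx s * dx s + cy s * dy s = r s * q s * cos (th s - ph s).
    by rewrite pmulr_rgt0// mulr_gt0.
  by rewrite cxE cyE dxE dyE cosB; ring.
- by rewrite intrB mulrBr; lra.
Qed.

Lemma winding_normsq_gt0 cx cy n : winding cx cy n ->
  forall s, 0 <= s <= 2 * pi -> 0 < cx s * cx s + cy s * cy s.
Proof.
move=> [th [r [_ [c_polar _]]]] s /c_polar[r0 [-> ->]].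
rewrite (_ : _ + _ = r s ^+ 2 * (cos (th s) ^+ 2 + sin (th s) ^+ 2)); last ring.
by rewrite cos2Dsin2 mulr1 exprn_gt0.
Qed.

Lemma winding_unique cx cy m n : winding cx cy m -> winding cx cy n -> m = n.
Proof. by move=> wm wn; apply: winding_dot_gt0 wm wn (winding_normsq_gt0 wm). Qed.

Lemma winding_mirror cx cy n : winding cx cy n ->
  winding (fun s => - cx s) cy (- n).
Proof.
move=> [th [r [cth [c_polar th_turn]]]]; exists (fun s => pi - th s), r; split; [|split].
- by move=> s; apply: cvgB; [exact: cvg_cst|exact: cth].
- move=> s /c_polar[r0 [-> ->]]; rewrite cosB sinB cospi sinpi.
  by do ![split=> //]; ring.
- by rewrite mulrNz mulrN; lra.
Qed.

Lemma winding_rotating_frame cx cy n : winding cx cy n ->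
  winding (fun s => cx s * cos s - cy s * sin s)
          (fun s => cx s * sin s + cy s * cos s) (n + 1).
Proof.
move=> [th [r [cth [c_polar th_turn]]]]; exists (fun s => th s + s), r; split; [|split].
- move=> s; apply: cvgD; first exact: cth.
  exact: (continuous_subspaceT (fun=> cvg_id)).
- move=> s /c_polar[r0 [-> ->]]; rewrite cosD sinD.
  by do ![split=> //]; ring.
- by rewrite intrD; lra.
Qed.

(* Nearby curves of the family never point in opposite directions. *)
Lemma winding_homotopy (cx cy : R -> R -> R) (n : R -> int) a b :
  (forall t s, a < t < b -> {for (t, s), continuous (fun z => cx z.1 z.2)}) ->
  (forall t s, a < t < b -> {for (t, s), continuous (fun z => cy z.1 z.2)}) ->
  (forall t, a < t < b -> winding (cx t) (cy t) (n t)) ->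
  forall t u, a < t < b -> a < u < b -> n t = n u.
Proof.
move=> ccx ccy wn t u tab uab.
apply: (@locally_cst_itv R int `]a, b[) => // r; rewrite in_itv/= => rab.
have frozen (c : R -> R -> R) s : {for (r, s), continuous (fun z => c z.1 z.2)} ->
    {for (r, s), continuous (fun z : R * R => c r z.2)}.
  move=> cc; apply: (@continuous_comp _ _ _ snd (c r)); first exact: cvg_snd.
  exact: (continuous_slice cc).
have near_dot_gt0 : \forall x \near r, forall s, `[0, 2 * pi]%classic s ->
    0 < cx x s * cx r s + cy x s * cy r s.
  apply: (near_compact_gt0 (G := fun z => cx z.1 z.2 * cx r z.2 + cy z.1 z.2 * cy r z.2)).
  - exact: segment_compact.
  - move=> s _; have cxs := ccx r s rab; have cys := ccy r s rab.
    exact: (cvgD (cvgM cxs (frozen cx s cxs)) (cvgM cys (frozen cy s cys))).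
  - by move=> s; rewrite /= in_itv/=; exact: winding_normsq_gt0 (wn r rab) s.
have [ar rb] := andP rab; near=> x; have xab : a < x < b.
  by apply/andP; split; near: x; [exact: lt_nbhsr|exact: lt_nbhsl].
apply: (winding_dot_gt0 (wn x xab) (wn r rab)) => s s2pi.
have : `[0, 2 * pi]%classic s by rewrite /= in_itv.
by move: s {s2pi}; near: x.
Unshelve. all: by end_near. Qed.

Lemma rotation_angle p q w : continuous w ->
  (forall s, is_derive s 1 p (- (w s * q s))) ->
  (forall s, is_derive s 1 q (w s * p s)) ->
  p 0 ^+ 2 + q 0 ^+ 2 = 1 ->
  exists th, forall s,
    [/\ is_derive s 1 th (w s), p s = cos (th s) & q s = sin (th s)].
Proof.
move=> cw dp dq pq0; have [W dW] := continuous_primitive cw.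
have [th0 [p0 q0]] := unit_circle_angle pq0.
pose th s := W s + (th0 - W 0).
have dth s : is_derive s 1 th (w s).
  apply: (is_derive_eq (is_deriveD (dW s) (is_derive_cst (th0 - W 0) s 1))).
  by rewrite addr0.
pose gap s := (p s - cos (th s)) * (p s - cos (th s)) +
  (q s - sin (th s)) * (q s - sin (th s)).
have gap0 s : gap s = 0.
  have -> : 0 = gap 0.
    by rewrite /gap /th [W 0 + _]addrC subrK p0 q0 !subrr mulr0 addr0.
  apply: is_derive_0_is_cst => x.
  have dpc := is_deriveB (dp x) (is_derive1_comp (is_derive_cos (th x)) (dth x)).
  have dqs := is_deriveB (dq x) (is_derive1_comp (is_derive_sin (th x)) (dth x)).
  apply: (is_derive_eq (is_deriveD (is_derive1M dpc dpc) (is_derive1M dqs dqs))).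
  by rewrite !fctE; ring.
exists th => s; split=> //; have := gap0 s; rewrite /gap -!expr2 => /eqP.
- by rewrite paddr_eq0 ?sqr_ge0// !sqrf_eq0 !subr_eq0 => /andP[/eqP].
- by rewrite paddr_eq0 ?sqr_ge0// !sqrf_eq0 !subr_eq0 => /andP[_ /eqP].
Qed.

Lemma unit_loop_winding p q w : continuous w ->
  (forall s, is_derive s 1 p (- (w s * q s))) ->
  (forall s, is_derive s 1 q (w s * p s)) ->
  p 0 ^+ 2 + q 0 ^+ 2 = 1 -> p (2 * pi) = p 0 -> q (2 * pi) = q 0 ->
  exists2 n, winding p q n &
    (\int[lebesgue_measure]_(s in `[0%R, (2 * pi)%R]) (w s)%:E = (2 * pi * n%:~R)%:E)%E.
Proof.
move=> cw dp dq pq0 p_loop q_loop.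
have [th dth] := rotation_angle cw dp dq pq0.
have cth s : {for s, continuous th} by have [/is_derive1_continuous] := dth s.
have [n th_turn] : exists n : int, th (2 * pi) - th 0 = 2 * pi * n%:~R.
  have [_ p0E q0E] := dth 0; have [_ p1E q1E] := dth (2 * pi).
  by apply: eq_cos_sin; rewrite -?p0E -?p1E -?q0E -?q1E.
exists n.
- exists th, (fun=> 1); split; first exact: continuous_subspaceT.
  by split=> // s _; have [_ pE qE] := dth s; rewrite !mul1r.
- by rewrite -th_turn; apply: integral_primitive => // s; have [] := dth s.
Qed.

End Winding.

Section RectangleIntegrals.
Variable R : realType.

Lemma open_measurable_prod (U : set (measurableTypeR R * measurableTypeR R)) :
  @open (R * R)%type U -> measurable U.
Proof.
move=> oU.
pose box (q : (rat * rat) * (rat * rat)) : set (measurableTypeR R * measurableTypeR R) :=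
  `]ratr q.1.1, ratr q.1.2[%classic `*` `]ratr q.2.1, ratr q.2.2[%classic.
have -> : U = \bigcup_(q in [set q | box q `<=` U]) box q.
  apply/seteqP; split => [[x y] Uxy|z [q /= qU qz]]; last exact: qU.
  have /nbhs_ballP[e /= e0 eU] : nbhs ((x, y) : R * R) U.
    by apply: open_nbhs_nbhs; split.
  have rat_around z : exists q : rat * rat, z - e < ratr q.1 < z /\ z < ratr q.2 < z + e.
    have [|q1 q1z] := @rat_in_itvoo R (z - e) z; first by rewrite ltrBlDr ltrDl.
    have [|q2 q2z] := @rat_in_itvoo R z (z + e); first by rewrite ltrDl.
    by exists (q1, q2); move: q1z q2z; rewrite !in_itv.
  have [qx [/andP[x1 x2] /andP[x3 x4]]] := rat_around x.
  have [qy [/andP[y1 y2] /andP[y3 y4]]] := rat_around y.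
  exists (qx, qy); last by split => /=; rewrite in_itv/= ?x2 ?x3 ?y2 ?y3.
  move=> [u w] [/=]; rewrite !in_itv/= => /andP[u1 u2] /andP[w1 w2].
  apply: eU; split => /=; rewrite /ball/= ltr_norml; lra.
rewrite bigcup_mkcond; apply: countable_bigcupT_measurable => [|q].
  exact: countableP.
by case: ifPn => // _; apply: measurableX; exact: measurable_itv.
Qed.

Lemma open_continuous_measurable_fun_prod
    (D : set (measurableTypeR R * measurableTypeR R)) (h : R * R -> R) :
  @open (R * R)%type D -> (forall z : R * R, D z -> {for z, continuous h}) ->
  measurable_fun D h.
Proof.
move=> oD ch; move=> mD; apply: (measurability _ (RGenOpens.measurableE R)) => //.
move=> _ [_ [a [b ->] <-]]; apply: open_measurable_prod.
rewrite openE => z [Dz hz]; apply: filterI.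
  by apply: open_nbhs_nbhs; split.
apply: (ch z Dz); apply: open_nbhs_nbhs; split => //; exact: interval_open.
Qed.

Lemma open_rectangle (a b c d : R) :
  @open (R * R)%type (`]a, b[%classic `*` `]c, d[%classic).
Proof.
rewrite openE => -[x y] [xab ycd]; exists (`]a, b[%classic, `]c, d[%classic) => //.
by split; apply: open_nbhs_nbhs; split => //; exact: interval_open.
Qed.

Lemma ge0_le_integral_nonmeasurable d (T : measurableType d)
    (mu : {measure set T -> \bar R}) (D : set T) (f g : T -> \bar R) :
  (forall x, D x -> (0 <= f x)%E) -> (forall x, D x -> (f x <= g x)%E) ->
  (\int[mu]_(x in D) f x <= \int[mu]_(x in D) g x)%E.
Proof.
move=> f0 fg; have g0 x : D x -> (0 <= g x)%E.
  by move=> Dx; apply: le_trans (f0 x Dx) (fg x Dx).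
rewrite !ge0_integralE//; apply: ereal_sup_le => _ /= [h hle <-]; exists h => // x.
by apply: le_trans (hle x) _; apply: lee_restrict.
Qed.

Lemma ge0_le_integral_prod d1 d2 (T1 : measurableType d1) (T2 : measurableType d2)
    (m1 : {sigma_finite_measure set T1 -> \bar R})
    (m2 : {sigma_finite_measure set T2 -> \bar R})
    (A : set T1) (B : set T2) (f : T1 -> \bar R) (g : T1 * T2 -> \bar R) :
  measurable A -> measurable B -> measurable_fun (A `*` B) g ->
  (forall z, (A `*` B) z -> (0 <= g z)%E) -> (forall x, A x -> (0 <= f x)%E) ->
  (forall x, A x -> (f x <= \int[m2]_(y in B) g (x, y))%E) ->
  (\int[m1]_(x in A) f x <= \int[(m1 \x m2)%E]_(z in A `*` B) g z)%E.
Proof.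
move=> mA mB mg g0 f0 fg; have mAB : measurable (A `*` B) by exact: measurableX.
rewrite [in leRHS]integral_mkcond fubini_tonelli1; last 2 first.
- exact/(measurable_restrictT _ _).1.
- by move=> z; exact: erestrict_ge0.
rewrite [in leLHS]integral_mkcond; apply: ge0_le_integral_nonmeasurable => x _.
  exact: erestrict_ge0.
rewrite patchE; case: ifPn => [/set_mem Ax|_]; last first.
  by apply: integral_ge0 => y _; exact: erestrict_ge0.
apply: (le_trans (fg x Ax)); rewrite /fubini_F [in leLHS]integral_mkcond.
rewrite le_eqVlt; apply/orP; left; apply/eqP; apply: eq_integral => y _.
by rewrite !patchE classical_sets.in_setX (mem_set Ax).
Qed.

End RectangleIntegrals.

Section SpeedIntegrals.
Variable R : realType.
Implicit Types (f g h : R -> R) (a b c d k m t x : R).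

Lemma cvg_sqrt (T : Type) (F : set_system T) (FF : Filter F) (h : T -> R) l :
  h x @[x --> F] --> l -> Num.sqrt (h x) @[x --> F] --> Num.sqrt l.
Proof. by move=> hl; apply: continuous_cvg => //; exact: sqrt_continuous. Qed.

Lemma cauchy_schwarz2 a b c d :
  a * c + b * d <= Num.sqrt (a ^+ 2 + b ^+ 2) * Num.sqrt (c ^+ 2 + d ^+ 2).
Proof.
rewrite (le_trans (ler_norm _))// -sqrtr_sqr -sqrtrM ?addr_ge0 ?sqr_ge0//.
apply: ler_wsqrtr; rewrite -subr_ge0.
by rewrite (_ : _ - _ = (a * d - b * c) ^+ 2) ?sqr_ge0//; ring.
Qed.

(* The integrand dominates its linearisation [g] in the direction [(c, m)], and
   the integral of [g] only sees the mean of [f]. *)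
Lemma integral_hypot_ge_mean f a b c m : a < b -> continuous f ->
  (\int[lebesgue_measure]_(x in `[a, b]) (f x)%:E = ((b - a) * m)%:E)%E ->
  (((b - a) * Num.sqrt (c ^+ 2 + m ^+ 2))%:E <=
   \int[lebesgue_measure]_(x in `[a, b]) (Num.sqrt (c ^+ 2 + f x ^+ 2))%:E)%E.
Proof.
move=> ab cf f_mean; set H := Num.sqrt (c ^+ 2 + m ^+ 2).
have [H0|] := leP H 0.
  apply: (@le_trans _ _ 0%E); last by apply: integral_ge0 => x _; rewrite lee_fin.
  by rewrite lee_fin pmulr_rle0// subr_gt0.
move=> H_gt0; have HE : H ^+ 2 = c ^+ 2 + m ^+ 2 by rewrite sqr_sqrtr ?addr_ge0 ?sqr_ge0.
pose g x := (c ^+ 2 + f x * m) / H.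
have cg : continuous g.
  move=> x; apply: cvgM; last exact: cvg_cst.
  by apply: cvgD; [exact: cvg_cst|apply: cvgM; [exact: cf|exact: cvg_cst]].
have cF : continuous (fun x => Num.sqrt (c ^+ 2 + f x ^+ 2)).
  move=> x; apply: cvg_sqrt.
  by apply: cvgD; [exact: cvg_cst|apply: cvgM; exact: cf].
have g_le x : g x <= Num.sqrt (c ^+ 2 + f x ^+ 2).
  by rewrite /g ler_pdivrMr// expr2; exact: cauchy_schwarz2.
have [F dF] := continuous_primitive cf.
have F_mean : F b - F a = (b - a) * m.
  by apply: EFin_inj; rewrite -f_mean (integral_primitive ab cf dF).
have dG x : is_derive x 1 (fun x => (c ^+ 2 * x + F x * m) / H) (g x).
  have dcx := is_derive1_cstM (c ^+ 2) (is_derive_id x 1).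
  have dFm := is_derive1M (dF x) (is_derive_cst m x 1).
  apply: (is_derive_eq (is_derive1M (is_deriveD dcx dFm) (is_derive_cst H^-1 x 1))).
  by rewrite /g /cst; ring.
have -> : (b - a) * H = (c ^+ 2 * b + F b * m) / H - (c ^+ 2 * a + F a * m) / H.
  rewrite -mulrBl (_ : _ + F b * m - _ = (b - a) * H ^+ 2); first by field; rewrite gt_eqF.
  by rewrite HE (_ : F b = F a + (b - a) * m); [ring|rewrite -F_mean; ring].
rewrite -(integral_primitive ab cg dG); apply: le_integral => //.
- exact: continuous_integrable_segment.
- exact: continuous_integrable_segment.
- by move=> x _; rewrite lee_fin.
Qed.

Lemma integral_cosN g : continuous g ->
  (\int[lebesgue_measure]_(t in `[0%R, pi]) (g (- cos t))%:E =
   \int[lebesgue_measure]_(t in `[0%R, pi]) (g (cos t))%:E)%E.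
Proof.
move=> cg; have cgc : continuous (g \o cos).
  by move=> t; apply: continuous_comp; [exact: continuous_cos|exact: cg].
have cgNc : continuous (fun t => g (- cos t)).
  by move=> t; apply: continuous_comp; [apply: cvgN; exact: continuous_cos|exact: cg].
have [G dG] := continuous_primitive cgc.
have dGN t : is_derive t 1 (fun t => - G (pi - t)) (g (- cos t)).
  have dt := is_deriveB (is_derive_cst pi t 1) (is_derive_id t 1).
  apply: (is_derive_eq (is_deriveN (is_derive1_comp (dG _) dt))).
  by rewrite fctE cosB cospi sinpi mul0r addr0 sub0r mulrN1 opprK mulN1r.
rewrite (integral_primitive (pi_gt0 R) cgNc dGN) (integral_primitive (pi_gt0 R) cgc dG).
by congr EFin; rewrite subrr subr0; ring.
Qed.

Lemma integral_cos_double g : continuous g ->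
  (\int[lebesgue_measure]_(t in `[0%R, (2 * pi)%R]) (g (cos (2 * t)))%:E =
   2%:E * \int[lebesgue_measure]_(t in `[0%R, pi]) (g (cos t))%:E)%E.
Proof.
move=> cg; have cgc : continuous (g \o cos).
  by move=> t; apply: continuous_comp; [exact: continuous_cos|exact: cg].
have cgc2 : continuous (fun t => g (cos (2 * t))).
  by move=> t; apply: (@continuous_comp _ _ _ (fun t => 2 * t) (g \o cos));
    [apply: cvgM; [exact: cvg_cst|exact: cvg_id]|exact: cgc].
have [G dG] := continuous_primitive cgc.
have dG2 t : is_derive t 1 (fun t => 2^-1 * G (2 * t)) (g (cos (2 * t))).
  have := is_derive1_cstM 2^-1 (is_derive1_comp (dG _) (is_derive1_cstM 2 (is_derive_id t 1))).
  by move/is_derive_eq; apply; rewrite !fctE; field.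
have pi2 : 0 < 2 * pi :> R by rewrite mulr_gt0// pi_gt0.
rewrite (integral_primitive pi2 cgc2 dG2) (integral_primitive (pi_gt0 R) cgc dG) -EFinM.
have G_period x y : G (x + 2 * pi) - G x = G (y + 2 * pi) - G y.
  apply: (primitive_periodic dG) => z.
  by rewrite /= -[in RHS](cosD2piz z 1) mulr1.
have G_odd := primitive_even dG (fun x => congr1 g (cosN x)).
have := G_period (2 * pi) 0; have := G_period (- pi) 0; have := G_odd pi.
rewrite add0r mulr0 (_ : 2 * (2 * pi) = 2 * pi + 2 * pi); last by ring.
by rewrite (_ : - pi + 2 * pi = pi); [move=> *; congr EFin; lra|ring].
Qed.

Lemma continuous_sqrt_affine a b : continuous (fun x => Num.sqrt (a + b * x)).
Proof.
move=> x; apply: cvg_sqrt; apply: cvgD; first exact: cvg_cst.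
by apply: cvgM; [exact: cvg_cst|exact: cvg_id].
Qed.

(* The distance from [- m] to the point [e^{it}] of the unit circle. *)
Definition chord m t : R := Num.sqrt (1 + m ^+ 2 + 2 * m * cos t).

Lemma continuous_chord m : continuous (chord m).
Proof.
move=> t; apply: (@continuous_comp _ _ _ cos
  (fun x => Num.sqrt (1 + m ^+ 2 + 2 * m * x))); first exact: continuous_cos.
exact: continuous_sqrt_affine.
Qed.

Lemma integral_chordN m :
  (\int[lebesgue_measure]_(t in `[0%R, pi]) (chord (- m) t)%:E =
   \int[lebesgue_measure]_(t in `[0%R, pi]) (chord m t)%:E)%E.
Proof.
rewrite -(integral_cosN (g := fun x => Num.sqrt (1 + m ^+ 2 + 2 * m * x))).
  by apply: eq_integral => t _; rewrite /chord sqrrN mulrN !mulNr mulrN.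
exact: continuous_sqrt_affine.
Qed.

Lemma ellipse_speedE k t :
  Num.sqrt (derive1 (fun u => k * cos u) t ^+ 2 +
            derive1 (fun u => (k - 2) * sin u) t ^+ 2) = chord (1 - k) (2 * t).
Proof.
have dx := is_derive1_cstM k (is_derive_cos t).
have dy := is_derive1_cstM (k - 2) (is_derive_sin t).
rewrite !derive1E (@derive_val _ _ _ _ _ _ _ dx) (@derive_val _ _ _ _ _ _ _ dy).
rewrite /chord [2 * t]mulr_natl cos_mulr2n; congr Num.sqrt.
by ring: (sin2cos2 t).
Qed.

Lemma ellipse_lengthE k : ellipse_length k =
  (2%:E * \int[lebesgue_measure]_(t in `[0%R, pi]) (chord (k - 1) t)%:E)%E.
Proof.
rewrite /ellipse_length /curve_length /seg; under eq_integral do rewrite ellipse_speedE.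
rewrite -integral_chordN opprB.
apply: (integral_cos_double (g := fun x => Num.sqrt (1 + (1 - k) ^+ 2 + 2 * (1 - k) * x))).
exact: continuous_sqrt_affine.
Qed.

End SpeedIntegrals.

Section VectorCalculus.
Variable R : realType.
Implicit Types (p q u w : vec3 R) (a b t s : R) (F G : R -> vec3 R).

Lemma dot3_lincomb a b p q w :
  dot3 (add3 (scale3 a p) (scale3 b q)) w = a * dot3 p w + b * dot3 q w.
Proof. by rewrite /dot3 /add3 /scale3 /vx /vy /vz /=; ring. Qed.

Lemma sph_frame_dot p q t s : dot3 p q =
  dot3 p (sph t s) * dot3 q (sph t s) + dot3 p (e_t t s) * dot3 q (e_t t s) +
  dot3 p (e_s t s) * dot3 q (e_s t s).
Proof.
rewrite /dot3 /sph /e_t /e_s /vx /vy /vz /=.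
by ring: (sin2cos2 t) (sin2cos2 s).
Qed.

Lemma sph_tangent_projection p t s : dot3 p (sph t s) = 0 ->
  vx p = cos t * dot3 p (e_t t s) * cos s - dot3 p (e_s t s) * sin s /\
  vy p = cos t * dot3 p (e_t t s) * sin s + dot3 p (e_s t s) * cos s.
Proof.
move=> p_tangent; split.
- rewrite -[LHS]subr0 -(mulr0 (sin t * cos s)) -p_tangent.
  by rewrite /dot3 /sph /e_t /e_s /vx /vy /vz /=; ring: (sin2cos2 t) (sin2cos2 s).
- rewrite -[LHS]subr0 -(mulr0 (sin t * sin s)) -p_tangent.
  by rewrite /dot3 /sph /e_t /e_s /vx /vy /vz /=; ring: (sin2cos2 t) (sin2cos2 s).
Qed.

Lemma cross_sph_dot_e_t p t s :
  dot3 (cross3 p (sph t s)) (e_t t s) = dot3 p (e_s t s).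
Proof.
rewrite /dot3 /cross3 /sph /e_t /e_s /vx /vy /vz /=.
by ring: (sin2cos2 t) (sin2cos2 s).
Qed.

Lemma cross_sph_dot_e_s p t s :
  dot3 (cross3 p (sph t s)) (e_s t s) = - dot3 p (e_t t s).
Proof.
rewrite /dot3 /cross3 /sph /e_t /e_s /vx /vy /vz /=.
by ring: (sin2cos2 t) (sin2cos2 s).
Qed.

Lemma cross_sph_dot_sph p t s : dot3 (cross3 p (sph t s)) (sph t s) = 0.
Proof. by rewrite /dot3 /cross3 /vx /vy /vz /=; ring. Qed.

Lemma cross_derive_dot p q u w :
  dot3 (add3 (cross3 u q) (cross3 p w)) p = - dot3 u (cross3 p q).
Proof. by rewrite /dot3 /add3 /cross3 /vx /vy /vz /=; ring. Qed.

Definition is_derive3 s F u : Prop :=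
  [/\ is_derive s 1 (fun x => vx (F x)) (vx u), is_derive s 1 (fun x => vy (F x)) (vy u) &
      is_derive s 1 (fun x => vz (F x)) (vz u)].

Lemma is_derive3_dot s F G u w : is_derive3 s F u -> is_derive3 s G w ->
  is_derive s 1 (fun x => dot3 (F x) (G x)) (dot3 u (G s) + dot3 (F s) w).
Proof.
move=> [Fx Fy Fz] [Gx Gy Gz].
have := is_deriveD (is_deriveD (is_derive1M Fx Gx) (is_derive1M Fy Gy)) (is_derive1M Fz Gz).
by move/is_derive_eq; apply; rewrite /dot3; ring.
Qed.

Lemma is_derive3_cross s F G u w : is_derive3 s F u -> is_derive3 s G w ->
  is_derive3 s (fun x => cross3 (F x) (G x)) (add3 (cross3 u (G s)) (cross3 (F s) w)).
Proof.
move=> [Fx Fy Fz] [Gx Gy Gz]; split.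
- have := is_deriveB (is_derive1M Fy Gz) (is_derive1M Fz Gy).
  by move/is_derive_eq; apply; rewrite /add3 /cross3 /vx /vy /vz /=; ring.
- have := is_deriveB (is_derive1M Fz Gx) (is_derive1M Fx Gz).
  by move/is_derive_eq; apply; rewrite /add3 /cross3 /vx /vy /vz /=; ring.
- have := is_deriveB (is_derive1M Fx Gy) (is_derive1M Fy Gx).
  by move/is_derive_eq; apply; rewrite /add3 /cross3 /vx /vy /vz /=; ring.
Qed.

Lemma is_derive3_derive1 s F u : is_derive3 s F u ->
  mk3 (derive1 (fun x => vx (F x)) s) (derive1 (fun x => vy (F x)) s)
      (derive1 (fun x => vz (F x)) s) = u.
Proof.
by case=> -[_ xE] [_ yE] [_ zE]; rewrite !derive1E xE yE zE /mk3 -!surjective_pairing.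
Qed.

Lemma is_derive3_sph_t t s : is_derive3 t (fun r => sph r s) (e_t t s).
Proof.
split.
- have := is_derive1M (is_derive_sin t) (is_derive_cst (cos s) t 1).
  by move/is_derive_eq; apply; rewrite mulr0 addr0.
- have := is_derive1M (is_derive_sin t) (is_derive_cst (sin s) t 1).
  by move/is_derive_eq; apply; rewrite mulr0 addr0.
- exact: is_derive_cos.
Qed.

Lemma is_derive3_sph_s t s : is_derive3 s (sph t) (scale3 (sin t) (e_s t s)).
Proof.
split.
- exact: is_derive1_cstM (is_derive_cos s).
- exact: is_derive1_cstM (is_derive_sin s).
- by apply: (is_derive_eq (is_derive_cst (cos t) s 1)); rewrite /vz /= mulr0.
Qed.

Lemma is_derive3_e_t t s : is_derive3 s (e_t t) (scale3 (cos t) (e_s t s)).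
Proof.
split.
- exact: is_derive1_cstM (is_derive_cos s).
- exact: is_derive1_cstM (is_derive_sin s).
- by apply: (is_derive_eq (is_derive_cst (- sin t) s 1)); rewrite /vz /= mulr0.
Qed.

Lemma is_derive3_e_s t s : is_derive3 s (e_s t)
  (add3 (scale3 (- cos t) (e_t t s)) (scale3 (- sin t) (sph t s))).
Proof.
split.
- apply: (is_derive_eq (is_deriveN (is_derive_sin s))).
  by rewrite /add3 /scale3 /mk3 /vx /vy /vz /=; ring: (sin2cos2 t).
- apply: (is_derive_eq (is_derive_cos s)).
  by rewrite /add3 /scale3 /mk3 /vx /vy /vz /=; ring: (sin2cos2 t).
- apply: (is_derive_eq (is_derive_cst (0 : R) s 1)).
  by rewrite /add3 /scale3 /mk3 /vx /vy /vz /=; ring.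
Qed.

Section Continuity.
Variables (T : topologicalType) (x : T).

Lemma continuous_coord3 (F : T -> vec3 R) : {for x, continuous F} ->
  [/\ {for x, continuous (fun y => vx (F y))}, {for x, continuous (fun y => vy (F y))} &
      {for x, continuous (fun y => vz (F y))}].
Proof.
move=> cF; split.
- exact: (cvg_comp _ _ (cvg_comp _ _ cF cvg_fst) cvg_fst).
- exact: (cvg_comp _ _ (cvg_comp _ _ cF cvg_fst) cvg_snd).
- exact: (cvg_comp _ _ cF cvg_snd).
Qed.

Lemma continuous3 (F : T -> vec3 R) : {for x, continuous (fun y => vx (F y))} ->
  {for x, continuous (fun y => vy (F y))} -> {for x, continuous (fun y => vz (F y))} ->
  {for x, continuous F}.
Proof.
move=> cx cy cz; have -> : F = fun y => (vx (F y), vy (F y), vz (F y)).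
  by apply/funext => y; rewrite -!surjective_pairing.
apply: (@cvg_pair _ _ _ (nbhs x) (nbhs (vx (F x), vy (F x))) (nbhs (vz (F x)))) => //.
exact: (@cvg_pair _ _ _ (nbhs x) (nbhs (vx (F x))) (nbhs (vy (F x)))).
Qed.

Lemma continuous_dot3 (F G : T -> vec3 R) : {for x, continuous F} ->
  {for x, continuous G} -> {for x, continuous (fun y => dot3 (F y) (G y))}.
Proof.
move=> /continuous_coord3[Fx Fy Fz] /continuous_coord3[Gx Gy Gz].
by apply: cvgD; [apply: cvgD|]; apply: cvgM.
Qed.

Lemma continuous_cross3 (F G : T -> vec3 R) : {for x, continuous F} ->
  {for x, continuous G} -> {for x, continuous (fun y => cross3 (F y) (G y))}.
Proof.
move=> /continuous_coord3[Fx Fy Fz] /continuous_coord3[Gx Gy Gz].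
by apply: continuous3; apply: cvgB; apply: cvgM.
Qed.

End Continuity.

Lemma continuous_sph_frame (z : R * R) :
  [/\ {for z, continuous (fun z : R * R => sph z.1 z.2)},
      {for z, continuous (fun z : R * R => e_t z.1 z.2)} &
      {for z, continuous (fun z : R * R => e_s z.1 z.2)}].
Proof.
have ct : {for z, continuous (fun z : R * R => cos z.1)}.
  by apply: continuous_comp; [exact: cvg_fst|exact: continuous_cos].
have st : {for z, continuous (fun z : R * R => sin z.1)}.
  by apply: continuous_comp; [exact: cvg_fst|exact: continuous_sin].
have cs : {for z, continuous (fun z : R * R => cos z.2)}.
  by apply: continuous_comp; [exact: cvg_snd|exact: continuous_cos].
have ss : {for z, continuous (fun z : R * R => sin z.2)}.
  by apply: continuous_comp; [exact: cvg_snd|exact: continuous_sin].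
split; apply: continuous3.
- exact: cvgM st cs.
- exact: cvgM st ss.
- exact: ct.
- exact: cvgM ct cs.
- exact: cvgM ct ss.
- exact: cvgN st.
- exact: cvgN ss.
- exact: cs.
- exact: cvg_cst.
Qed.

End VectorCalculus.

Lemma smooth_on_C1 (R : realType) (U : set (R * R)) (f : R -> R -> R) t s :
  smooth_on U f -> U (t, s) ->
  [/\ is_derive t 1 (fun u => f u s) (d1 f t s), is_derive s 1 (f t) (d2 f t s),
      {for (t, s), continuous (fun w : R * R => f w.1 w.2)} &
      {for (t, s), continuous (fun w : R * R => d2 f w.1 w.2)}].
Proof.
move=> /(_ 1%N)[df [cf [_ cd2f]]] Uts; have [dt ds] := df _ Uts.
split; [| |exact: cf|exact: cd2f].
- by split; [exact: dt|rewrite -derive1E].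
- by split; [exact: ds|rewrite -derive1E].
Qed.

Section UnitField.
Variables (R : realType) (v : vec3 R -> vec3 R).
Hypothesis v_smooth : smooth_unit_field v.
Implicit Types (t s : R).

Definition meridional t s := dot3 (v (sph t s)) (e_t t s).
Definition zonal t s := dot3 (v (sph t s)) (e_s t s).

(* If [v] makes the angle [phi] with [e_t] in the frame [(e_t, e_s)], this is
   [d phi/d s + cos t], the rotation of [v] relative to parallel transport. *)
Definition turn_rate t s := - dot3 (pd2 (inchart v) t s) (vperp v (sph t s)).

Lemma sph_in_M t s : 0 < t < pi -> M (sph t s).
Proof.
move=> /sin_gt0_pi st; split; last first.
  by split; rewrite /sph => -[_ _ ct]; have := cos2Dsin2 t; rewrite ct; nra.
by rewrite /dot3 /sph /vx /vy /vz /=; ring: (sin2cos2 t) (sin2cos2 s).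
Qed.

Lemma field_tangent t s : 0 < t < pi -> dot3 (v (sph t s)) (sph t s) = 0.
Proof. by move=> /(sph_in_M s) /(proj1 v_smooth)[]. Qed.

Lemma field_unit t s : 0 < t < pi -> dot3 (v (sph t s)) (v (sph t s)) = 1.
Proof. by move=> /(sph_in_M s) /(proj1 v_smooth)[]. Qed.

Lemma meridional_zonal_unit t s : 0 < t < pi ->
  meridional t s ^+ 2 + zonal t s ^+ 2 = 1.
Proof.
move=> t0; rewrite -(field_unit s t0) (sph_frame_dot _ _ t s) field_tangent//.
by rewrite mulr0 add0r.
Qed.

Lemma field_projection t s : 0 < t < pi ->
  vx (v (sph t s)) = cos t * meridional t s * cos s - zonal t s * sin s /\
  vy (v (sph t s)) = cos t * meridional t s * sin s + zonal t s * cos s.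
Proof. by move=> t0; exact/sph_tangent_projection/field_tangent. Qed.

Lemma meridional_zonal_2pi t :
  meridional t (2 * pi) = meridional t 0 /\ zonal t (2 * pi) = zonal t 0.
Proof.
have c2pi : cos (2 * pi) = cos 0 :> R by rewrite mulr_natl cos2pi cos0.
have s2pi : sin (2 * pi) = sin 0 :> R by rewrite mulr_natl sin2pi sin0.
by rewrite /meridional /zonal /e_t /e_s /sph c2pi s2pi.
Qed.

Let in_chart t s : 0 < t < pi -> @chart_dom R (t, s). Proof. by []. Qed.

Lemma is_derive3_field t s : 0 < t < pi ->
  is_derive3 t (fun r => inchart v r s) (pd1 (inchart v) t s) /\
  is_derive3 s (inchart v t) (pd2 (inchart v) t s).
Proof.
case: v_smooth => _ [sx [sy sz]] /(in_chart s) t0.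
have [x1 x2 _ _] := smooth_on_C1 sx t0; have [y1 y2 _ _] := smooth_on_C1 sy t0.
by have [z1 z2 _ _] := smooth_on_C1 sz t0; split; split.
Qed.

Lemma continuous_field t s : 0 < t < pi ->
  {for (t, s), continuous (fun w : R * R => inchart v w.1 w.2)} /\
  {for (t, s), continuous (fun w : R * R => pd2 (inchart v) w.1 w.2)}.
Proof.
case: v_smooth => _ [sx [sy sz]] /(in_chart s) t0.
have [_ _ cx cx2] := smooth_on_C1 sx t0; have [_ _ cy cy2] := smooth_on_C1 sy t0.
have [_ _ cz cz2] := smooth_on_C1 sz t0; split; apply: continuous3.
- exact: cx.
- exact: cy.
- exact: cz.
- exact: cx2.
- exact: cy2.
- exact: cz2.
Qed.

Lemma continuous_meridional_zonal t s : 0 < t < pi ->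
  {for (t, s), continuous (fun w : R * R => meridional w.1 w.2)} /\
  {for (t, s), continuous (fun w : R * R => zonal w.1 w.2)}.
Proof.
move=> /(continuous_field s)[cv _]; have [_ ct cs] := continuous_sph_frame (t, s).
by split; [exact: continuous_dot3 cv ct|exact: continuous_dot3 cv cs].
Qed.

Lemma continuous_turn_rate t s : 0 < t < pi ->
  {for (t, s), continuous (fun w : R * R => turn_rate w.1 w.2)}.
Proof.
move=> /(continuous_field s)[cv cv2]; have [cp _ _] := continuous_sph_frame (t, s).
exact: cvgN (continuous_dot3 cv2 (continuous_cross3 cv cp)).
Qed.

Lemma continuous_turn_rate_parallel t : 0 < t < pi -> continuous (turn_rate t).
Proof.
move=> t0 s; apply: (@continuous_slice R R R turn_rate).
exact: continuous_turn_rate.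
Qed.

Lemma pd2_field_dot t s : 0 < t < pi -> dot3 (pd2 (inchart v) t s) (v (sph t s)) = 0.
Proof.
move=> t0; have [_ dv] := is_derive3_field s t0.
have := is_derive3_dot dv dv; rewrite (_ : (fun x => _) = cst 1); last first.
  by apply/funext => x; exact: field_unit.
case=> _; rewrite derive_cst /dot3 /inchart; lra.
Qed.

Lemma pd2_field_frame t s : 0 < t < pi ->
  dot3 (pd2 (inchart v) t s) (e_t t s) = - (turn_rate t s * zonal t s) /\
  dot3 (pd2 (inchart v) t s) (e_s t s) = turn_rate t s * meridional t s.
Proof.
move=> t0; have unit := meridional_zonal_unit s t0.
have := pd2_field_dot s t0; rewrite /turn_rate /vperp.
rewrite (sph_frame_dot _ (v _) t s) (sph_frame_dot _ (cross3 _ _) t s).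
rewrite field_tangent// cross_sph_dot_sph.
rewrite cross_sph_dot_e_t cross_sph_dot_e_s -/(meridional t s) -/(zonal t s).
set a := meridional t s in unit *; set b := zonal t s in unit *.
set x := dot3 _ (e_t t s); set y := dot3 _ (e_s t s) => xy0.
have {}xy0 : x * a + y * b = 0 by rewrite -[RHS]xy0; ring.
split.
- transitivity (x * (a ^+ 2 + b ^+ 2)); first by rewrite unit mulr1.
  transitivity (a * (x * a + y * b) - (y * a - x * b) * b); first by ring.
  by rewrite xy0; ring.
- transitivity (y * (a ^+ 2 + b ^+ 2)); first by rewrite unit mulr1.
  transitivity (b * (x * a + y * b) + (y * a - x * b) * a); first by ring.
  by rewrite xy0; ring.
Qed.

Lemma is_derive_meridional t s : 0 < t < pi ->
  is_derive s 1 (meridional t) (- ((turn_rate t s - cos t) * zonal t s)).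
Proof.
move=> t0; have [_ dv] := is_derive3_field s t0.
apply: (is_derive_eq (is_derive3_dot dv (is_derive3_e_t t s))).
rewrite (pd2_field_frame s t0).1 /zonal /inchart /dot3 /scale3 /vx /vy /vz /=; ring.
Qed.

Lemma is_derive_zonal t s : 0 < t < pi ->
  is_derive s 1 (zonal t) ((turn_rate t s - cos t) * meridional t s).
Proof.
move=> t0; have [_ dv] := is_derive3_field s t0.
apply: (is_derive_eq (is_derive3_dot dv (is_derive3_e_s t s))).
rewrite (pd2_field_frame s t0).2 -[RHS]addr0 -(mulr0 (- sin t)) -(field_tangent s t0).
by rewrite /meridional /inchart /dot3 /add3 /scale3 /vx /vy /vz /=; ring.
Qed.

Lemma pd1_vperp_dot t s : 0 < t < pi ->
  dot3 (pd1 (inchart (vperp v)) t s) (v (sph t s)) =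
  - dot3 (pd1 (inchart v) t s) (vperp v (sph t s)).
Proof.
move=> t0; have [dv _] := is_derive3_field s t0.
have := is_derive3_derive1 (is_derive3_cross dv (is_derive3_sph_t t s)).
by rewrite -[mk3 _ _ _]/(pd1 (inchart (vperp v)) t s) => ->; exact: cross_derive_dot.
Qed.

Lemma pd2_vperp_dot t s : 0 < t < pi ->
  dot3 (pd2 (inchart (vperp v)) t s) (v (sph t s)) = turn_rate t s.
Proof.
move=> t0; have [_ dv] := is_derive3_field s t0.
have := is_derive3_derive1 (is_derive3_cross dv (is_derive3_sph_s t s)).
by rewrite -[mk3 _ _ _]/(pd2 (inchart (vperp v)) t s) => ->; exact: cross_derive_dot.
Qed.

Lemma sasaki_density_sqr t s : 0 < t < pi ->
  (1 + gam v t s ^+ 2 + del v t s ^+ 2) * sin t ^+ 2 =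
  sin t ^+ 2 + turn_rate t s ^+ 2 +
  (sin t * dot3 (pd1 (inchart v) t s) (vperp v (sph t s))) ^+ 2.
Proof.
move=> t0; have st : sin t != 0 by rewrite gt_eqF// sin_gt0_pi.
rewrite /gam /del /dirder !dot3_lincomb pd1_vperp_dot// pd2_vperp_dot//.
rewrite cross_sph_dot_e_t cross_sph_dot_e_s -/(meridional t s) -/(zonal t s).
rewrite -[dot3 (pd2 _ _ _) _]opprK -/(turn_rate t s); set u := dot3 (pd1 _ _ _) _.
transitivity (sin t ^+ 2 + (meridional t s ^+ 2 + zonal t s ^+ 2) *
    (turn_rate t s ^+ 2 + (sin t * u) ^+ 2)); first by field.
by rewrite meridional_zonal_unit//; ring.
Qed.

Lemma sasaki_density_ge t s : 0 < t < pi ->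
  Num.sqrt (sin t ^+ 2 + turn_rate t s ^+ 2) <=
  Num.sqrt (1 + gam v t s ^+ 2 + del v t s ^+ 2) * sin t.
Proof.
move=> t0; rewrite -[X in _ * X]ger0_norm; last exact/ltW/sin_gt0_pi.
rewrite -sqrtr_sqr -sqrtrM ?addr_ge0 ?sqr_ge0// sasaki_density_sqr//.
by apply: ler_wsqrtr; rewrite lerDl sqr_ge0.
Qed.

End UnitField.

Section ParallelWinding.
Variables (R : realType) (v : vec3 R -> vec3 R).
Hypothesis v_smooth : smooth_unit_field v.
Implicit Types (t u s : R) (n : int).

Definition parallel_winding t n := winding (meridional v t) (zonal v t) n.

Lemma parallel_winding_turn t : 0 < t < pi -> exists2 n, parallel_winding t n &
  (\int[lebesgue_measure]_(s in `[0%R, (2 * pi)%R]) (turn_rate v t s)%:E =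
   ((2 * pi - 0) * (n%:~R + cos t))%:E)%E.
Proof.
move=> t0; have ctau := continuous_turn_rate_parallel v_smooth t0.
have comega : continuous (fun s => turn_rate v t s - cos t).
  by move=> s; apply: cvgB; [exact: ctau|exact: cvg_cst].
have [mer_loop zon_loop] := meridional_zonal_2pi v t.
have [n wn omega_int] := unit_loop_winding comega
  (fun s => is_derive_meridional v_smooth s t0) (fun s => is_derive_zonal v_smooth s t0)
  (meridional_zonal_unit v_smooth 0 t0) mer_loop zon_loop.
exists n => //; have pi2 : 0 < 2 * pi :> R by rewrite mulr_gt0// pi_gt0.
have [W dW] := continuous_primitive comega.
have W_turn : W (2 * pi) - W 0 = 2 * pi * n%:~R.
  by apply: EFin_inj; rewrite -omega_int (integral_primitive pi2 comega dW).
have dT s : is_derive s 1 (fun s => W s + s * cos t) (turn_rate v t s).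
  have dsc := is_derive1M (is_derive_id s 1) (is_derive_cst (cos t) s 1).
  by apply: (is_derive_eq (is_deriveD (dW s) dsc)); rewrite /cst; ring.
by rewrite (integral_primitive pi2 ctau dT); congr EFin; lra.
Qed.

Lemma parallel_winding_const t u n : 0 < t < pi -> 0 < u < pi ->
  parallel_winding t n -> parallel_winding u n.
Proof.
move=> t0 u0 wt; have exN r : exists m, 0 < r < pi -> parallel_winding r m.
  have [r0|_] := boolP (0 < r < pi); last by exists 0.
  by have [m wm _] := parallel_winding_turn r0; exists m.
have [N wN] := choice exN.
rewrite (winding_unique wt (wN t t0)).
rewrite (winding_homotopy (n := N) (a := 0) (b := pi) _ _ wN t0 u0); first exact: wN.
- by move=> r s r0; have [] := continuous_meridional_zonal v_smooth s r0.
- by move=> r s r0; have [] := continuous_meridional_zonal v_smooth s r0.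
Qed.

Definition projection_winding t n :=
  winding (fun s => vx (v (sph t s))) (fun s => vy (v (sph t s))) n.

Lemma projection_winding_north t n : 0 < t < pi -> 0 < cos t ->
  projection_winding t n -> parallel_winding t (n - 1).
Proof.
move=> t0 ct wn; have [m wm _] := parallel_winding_turn t0.
suff -> : n = m + 1 by rewrite addrK.
apply: (winding_dot_gt0 wn (winding_rotating_frame wm)) => s _.
have [-> ->] := field_projection v_smooth s t0.
have unit := meridional_zonal_unit v_smooth s t0.
set a := meridional v t s in unit *; set b := zonal v t s in unit *.
rewrite (_ : _ + _ = (cos t * a ^+ 2 + b ^+ 2) * (cos s ^+ 2 + sin s ^+ 2)); last by ring.
by rewrite cos2Dsin2 mulr1; have := sqr_ge0 a; have := sqr_ge0 b; nra.
Qed.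

(* In the southern hemisphere the projection to the plane reverses [e_t]. *)
Lemma projection_winding_south t n : 0 < t < pi -> cos t < 0 ->
  projection_winding t n -> parallel_winding t (1 - n).
Proof.
move=> t0 ct wn; have [m wm _] := parallel_winding_turn t0.
suff -> : n = - m + 1 by rewrite opprD opprK addrCA subrr addr0.
apply: (winding_dot_gt0 wn (winding_rotating_frame (winding_mirror wm))) => s _.
have [-> ->] := field_projection v_smooth s t0.
have unit := meridional_zonal_unit v_smooth s t0.
set a := meridional v t s in unit *; set b := zonal v t s in unit *.
rewrite (_ : _ + _ = (- cos t * a ^+ 2 + b ^+ 2) * (cos s ^+ 2 + sin s ^+ 2)); last by ring.
by rewrite cos2Dsin2 mulr1; have := sqr_ge0 a; have := sqr_ge0 b; nra.
Qed.

Lemma small_colatitude (e0 : R) : 0 < e0 ->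
  exists e, [/\ 0 < e < e0, 0 < e < pi & 0 < cos e].
Proof.
move=> e00; have pi0 := pi_gt0 R; exists (Num.min e0 (pi / 2) / 2).
have m0 : 0 < Num.min e0 (pi / 2) by rewrite lt_min e00 divr_gt0.
have [m1 m2] : Num.min e0 (pi / 2) <= e0 /\ Num.min e0 (pi / 2) <= pi / 2.
  by rewrite !ge_min !lexx orbT.
by split; [lra|lra|apply: cos_gt0_pihalf; lra].
Qed.

Lemma index_N_parallel_winding n : index_N v n ->
  forall t, 0 < t < pi -> parallel_winding t (n - 1).
Proof.
move=> [e0 [/small_colatitude[e [e_e0 e_pi ce]] wn]] t t0.
exact: parallel_winding_const e_pi t0 (projection_winding_north e_pi ce (wn e e_e0)).
Qed.

Lemma index_S_parallel_winding n : index_S v n ->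
  forall t, 0 < t < pi -> parallel_winding t (1 - n).
Proof.
move=> [e0 [/small_colatitude[e [e_e0 e_pi ce]] wn]] t t0.
have pie : 0 < pi - e < pi by lra.
have cpie : cos (pi - e) < 0 by rewrite cosB cospi sinpi; lra.
exact: parallel_winding_const pie t0 (projection_winding_south pie cpie (wn e e_e0)).
Qed.

Lemma parallel_integral_ge t n : 0 < t < pi -> parallel_winding t n ->
  ((2 * pi * chord n%:~R t)%:E <=
   \int[lebesgue_measure]_(s in `]0%R, (2 * pi)%R[)
     (Num.sqrt (sin t ^+ 2 + turn_rate v t s ^+ 2))%:E)%E.
Proof.
move=> t0 wn; have [m wm tau_int] := parallel_winding_turn t0.
have ctau := continuous_turn_rate_parallel v_smooth t0.
rewrite continuous_integral_oo; last first.
  by move=> s; apply: cvg_sqrt; apply: cvgD; [exact: cvg_cst|apply: cvgM; exact: ctau].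
have pi2 : 0 < 2 * pi :> R by rewrite mulr_gt0// pi_gt0.
apply: le_trans (integral_hypot_ge_mean (sin t) pi2 ctau tau_int).
rewrite (winding_unique wn wm) subr0 /chord lee_fin ler_pM2l// le_eqVlt; apply/orP; left.
by apply/eqP; congr Num.sqrt; ring: (sin2cos2 t).
Qed.

Lemma vol_ge_turn_rate :
  (\int[(@lebesgue_measure R \x @lebesgue_measure R)%E]_(z in @vol_dom R)
     (Num.sqrt (sin z.1 ^+ 2 + turn_rate v z.1 z.2 ^+ 2))%:E <= vol v)%E.
Proof.
apply: ge0_le_integral_nonmeasurable => -[t s] [/= + _]; rewrite in_itv/= => t0.
  by rewrite lee_fin.
by rewrite lee_fin; exact: sasaki_density_ge.
Qed.

Lemma measurable_turn_density : measurable_fun (@vol_dom R)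
  (fun z : measurableTypeR R * measurableTypeR R =>
     (Num.sqrt (sin z.1 ^+ 2 + turn_rate v z.1 z.2 ^+ 2))%:E).
Proof.
apply/measurable_EFinP; apply: open_continuous_measurable_fun_prod; 
  first exact: (@open_rectangle R 0 pi 0 (2 * pi)).
move=> [t s] [/= + _]; rewrite in_itv/= => t0.
have csin : {for (t, s), continuous (fun z : R * R => sin z.1)}.
  by apply: continuous_comp; [exact: cvg_fst|exact: continuous_sin].
have ctau := continuous_turn_rate v_smooth (s := s) t0.
by apply: cvg_sqrt; exact: (cvgD (cvgM csin csin) (cvgM ctau ctau)).
Qed.

Lemma vol_ge_integral_chord n : (forall t, 0 < t < pi -> parallel_winding t n) ->
  ((2 * pi)%:E * \int[lebesgue_measure]_(t in `[0%R, pi]) (chord n%:~R t)%:E <= vol v)%E.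
Proof.
move=> wn; apply: le_trans vol_ge_turn_rate.
have cchord := @continuous_chord R n%:~R.
have pi2 : 0 <= 2 * pi :> R by rewrite mulr_ge0// pi_ge0.
rewrite -(continuous_integral_oo 0 pi cchord) -ge0_integralZl//; last 2 first.
- apply/measurable_EFinP/measurable_funTS; exact: continuous_measurable_fun.
- by move=> t _; rewrite lee_fin sqrtr_ge0.
apply: ge0_le_integral_prod => //.
- exact: measurable_turn_density.
- by move=> t _; apply: mule_ge0; rewrite lee_fin ?sqrtr_ge0.
- by move=> t; rewrite /= in_itv/= => t0; exact: parallel_integral_ge (wn t t0).
Qed.

End ParallelWinding.

Theorem theorem1 (R : realType) (v : vec3 R -> vec3 R) (iN iS k : int) :
  smooth_unit_field v ->
  index_N v iN -> index_S v iS ->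
  k = Order.max iN iS -> (2 < k)%R ->
  ((pi%:E * ellipse_length (k%:~R : R)) <= vol v)%E.
Proof.
move=> v_smooth index_iN index_iS kE _.
rewrite ellipse_lengthE muleA -EFinM [pi * 2]mulrC.
have [iS_le|iN_lt] := leP iS iN.
- rewrite kE (max_l iS_le) -(intrB R iN 1).
  exact: (vol_ge_integral_chord v_smooth (index_N_parallel_winding v_smooth index_iN)).
- rewrite kE (max_r (ltW iN_lt)) -integral_chordN opprB -(intrB R 1 iS).
  exact: (vol_ge_integral_chord v_smooth (index_S_parallel_winding v_smooth index_iS)).
Qed.
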